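(* Let $R$ be a ring and $a\in R$. Then $a$ has at most one Hirano inverse in $R$, and if the Hirano inverse $a^H$ of $a$ exists, it is exactly the Drazin inverse of $a$, i.e., $a^H=a^D$.
   Context: All rings are associative with identity. $N(R)$ denotes the set of all nilpotent elements of $R$. An element $a\in R$ has Hirano inverse $b\in R$ if $a^2-ab\in N(R)$, $ab=ba$ and $b=bab$; a Hirano inverse of $a$ is denoted by $a^H$. An element $a\in R$ has Drazin inverse $b\in R$ if $a-a^2b\in N(R)$, $ab=ba$ and $b=bab$; such a $b$ is unique if it exists (a well-known fact) and is denoted by $a^D$. *)

(* Defs.v *)
From mathcomp Require Import all_boot all_algebra.

Set Implicit Arguments.
Unset Strict Implicit.
Unset Printing Implicit Defensive.

Import GRing.Theory.
Local Open Scope ring_scope.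

(* [pzRingType]: unital associative rings, not necessarily commutative, with
   the zero ring allowed. *)

Definition nilpotent_elt (R : pzRingType) (x : R) : Prop :=
  exists n : nat, x ^+ n = 0.

Definition is_hirano_inverse (R : pzRingType) (a b : R) : Prop :=
  [/\ nilpotent_elt (a ^+ 2 - a * b), a * b = b * a & b = b * a * b].

Definition is_drazin_inverse (R : pzRingType) (a b : R) : Prop :=
  [/\ nilpotent_elt (a - a ^+ 2 * b), a * b = b * a & b = b * a * b].

(* Main.v *)
Require Import Defs.
From mathcomp Require Import all_boot all_algebra.

(** Write e = ab for an outer inverse b of a commuting with a; e is an
    idempotent commuting with a.  The Drazin condition says that a(1 - e) is
    nilpotent, i.e. that a^n e = a^n for large n; the Hirano condition says
    that a^2 - e is nilpotent.

    A Hirano inverse is a Drazin inverse ([hirano_drazin]) because the square of a(1 - e) is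
    (a^2 - e)(1 - e), and the two factors commute.

    Drazin inverses b and c of a are equal ([drazin_uniq]) although it is not
    known beforehand that b and c commute with each other: for large n the
    idempotents e = ab and f = ac satisfy e = a^n b^n and f = c^n a^n, so
    fe equals f when e is absorbed by a^n, and equals e when f is.  Hence
    ab = ac, and this forces b = c.  Uniqueness of Hirano inverses follows. *)

Set Implicit Arguments.
Unset Strict Implicit.
Unset Printing Implicit Defensive.

Import GRing.Theory.
Local Open Scope ring_scope.

Section Inverses.

Variable R : pzRingType.
Implicit Types a b c e : R.

(** The extra factor e makes the formula true for k = 0 as well. *)
Lemma expr_idem_mul e k : e * e = e -> e ^+ k * e = e.
Proof. by move=> ee; elim: k => [|k IHk]; rewrite ?mul1r // exprS -mulrA IHk. Qed.

Lemma idem_compl e : e * e = e -> (1 - e) * (1 - e) = 1 - e.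
Proof. by move=> ee; rewrite mulrBl mul1r mulrBr mulr1 ee subrr subr0. Qed.

Lemma outer_idem a b : b = b * a * b -> (a * b) * (a * b) = a * b.
Proof. by move=> bab; rewrite -mulrA [b * (a * b)]mulrA -bab. Qed.

Lemma comm_compl a b : a * b = b * a -> GRing.comm a (1 - a * b).
Proof.
move=> ab; apply: commrB; first exact: commr1.
exact: commrM (commr_refl a) ab.
Qed.

Lemma sub_sqr_mulE a b : a * b = b * a -> a - a ^+ 2 * b = a * (1 - a * b).
Proof. by move=> ab; rewrite mulrBr mulr1 expr2 !mulrA. Qed.

Lemma hirano_drazin a b : is_hirano_inverse a b -> is_drazin_inverse a b.
Proof.
case=> [[n nil_n] ab bab]; split=> //; exists (2 * n)%N.
have ee := outer_idem bab; have ca := comm_compl ab.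
have sqrE : (a - a ^+ 2 * b) ^+ 2 = (a ^+ 2 - a * b) * (1 - a * b).
  rewrite sub_sqr_mulE // exprMn_comm // [X in _ * X]expr2 idem_compl //.
  by rewrite mulrBl [a * b * (1 - _)]mulrBr mulr1 ee subrr subr0.
rewrite exprM sqrE exprMn_comm ?nil_n ?mul0r //.
apply/commr_sym/commrB; first exact/commrX/commr_sym.
exact/commr_sym/commrB/commr_refl/commr1.
Qed.

(** As a commutes with the idempotent 1 - ab, the product
    a^n (1 - ab) = (a(1 - ab))^n (1 - ab) vanishes with the power of
    a - a^2 b; multiplying by powers of a extends this to all larger
    exponents, so that two Drazin inverses can share one exponent. *)
Lemma drazin_absorb a b : is_drazin_inverse a b ->
  exists n : nat, forall m : nat, (n <= m)%N -> a ^+ m * (a * b) = a ^+ m.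
Proof.
case=> [[n nil_n] ab bab]; exists n => m le_nm.
have: a ^+ n * (1 - a * b) = 0.
  rewrite -(expr_idem_mul n (idem_compl (outer_idem bab))) mulrA.
  by rewrite -(exprMn_comm _ (comm_compl ab)) -sub_sqr_mulE // nil_n mul0r.
move/eqP; rewrite mulrBr mulr1 subr_eq0 => /eqP an.
by rewrite -(subnK le_nm) exprD -mulrA -an.
Qed.

Lemma drazin_uniq a b c :
  is_drazin_inverse a b -> is_drazin_inverse a c -> b = c.
Proof.
move=> Db Dc; have [nb absb] := drazin_absorb Db.
have [nc absc] := drazin_absorb Dc.
case: Db Dc => [_ ab bab] [_ ac cac].
have {absb} anb := absb _ (leq_addr nc nb).
have {absc} anc := absc _ (leq_addl nb nc).
set n := (nb + nc)%N in anb anc.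
have fe_f : (a * c) * (a * b) = a * c.
  (* on both sides, f = f^n f, so that a factor c^n a^n appears before f *)
  rewrite -(expr_idem_mul n (outer_idem cac)) {1 3}ac exprMn_comm //.
  (* a^n absorbs first f, then e *)
  by rewrite -[_ * (a * c)]mulrA anc -mulrA anb.
have fe_e : (a * c) * (a * b) = a * b.
  have anf : (a * c) * a ^+ n = a ^+ n.
    rewrite -{2}anc; apply/commrX/commr_sym.
    exact: commrM (commr_refl a) ac.
  have eE : a * b = a ^+ n * (b ^+ n * (a * b)).
    by rewrite mulrA -exprMn_comm // expr_idem_mul //; apply: outer_idem.
  by rewrite eE mulrA anf.
have ef : a * b = a * c by rewrite -fe_e fe_f.
by rewrite bab -mulrA ef mulrA -ab ef ac -cac.
Qed.

End Inverses.

Theorem corollary2p2 (R : pzRingType) (a : R) :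
  (forall b c : R, is_hirano_inverse a b -> is_hirano_inverse a c -> b = c) /\
  (forall b : R, is_hirano_inverse a b -> unique (is_drazin_inverse a) b).
Proof.
split=> [b c /hirano_drazin Db /hirano_drazin Dc | b /hirano_drazin Db].
  exact: drazin_uniq Db Dc.
by split=> // c; apply: drazin_uniq.
Qed.
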